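(* There exists $N$ such that for every integer $n\ge N$ there is a partition $\lambda\vdash n$ such that the tensor fourth power $\lambda^{\otimes 4}=\lambda\otimes\lambda\otimes\lambda\otimes\lambda$ of the corresponding irreducible complex representation of the symmetric group $S_n$ contains every irreducible representation of $S_n$ as a summand with positive multiplicity.
   Context: Partitions $\lambda\vdash n$ are identified with the irreducible complex representations of $S_n$ in the usual way ($(n)$ is the trivial representation, $(1^n)$ the alternating one). Tensor products are inner tensor products of $S_n$-representations (diagonal action). A representation ''contains'' a partition $\mu$ if the irreducible representation indexed by $\mu$ occurs in it with positive multiplicity. *)

(* Defs.v *)
From HB Require Import structures.
From mathcomp Require Import all_boot all_order all_fingroup all_algebra.
From mathcomp Require Import all_solvable all_field all_character.

Set Implicit Arguments.
Unset Strict Implicit.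
Unset Printing Implicit Defensive.

Import GroupScope GRing.Theory.
Local Open Scope ring_scope.

Definition is_partition (n : nat) (la : seq nat) : bool :=
  [&& sorted geq la, 0%N \notin la & sumn la == n].

(* The boxes of the Young diagram of la are numbered 0, ..., n - 1, row after
   row from left to right. Box number k is then in row (reshape_index la k)
   and in column (reshape_offset la k). *)
Definition row_stab (n : nat) (la : seq nat) : {set 'S_n} :=
  [set p : 'S_n | [forall k : 'I_n, reshape_index la (p k) == reshape_index la k]].

Definition col_stab (n : nat) (la : seq nat) : {set 'S_n} :=
  [set q : 'S_n | [forall k : 'I_n, reshape_offset la (q k) == reshape_offset la k]].

Definition regS (n : nat) := regular_repr algC [set: 'S_n].

(* a_la * b_la, an element of the group algebra of S_n (over algC), given as a
   matrix of the regular representation *)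
Definition young_symmetrizer (n : nat) (la : seq nat) :=
  (\sum_(p in row_stab n la) regS n p)
    *m (\sum_(q in col_stab n la) (-1) ^+ (q : bool) *: regS n q).

(* The Specht module, i.e. the irreducible representation indexed by la: the
   submodule of the regular representation generated by the Young symmetrizer.
   It is a right ideal, since MathComp representations act on row vectors. *)
Definition specht_submod (n : nat) (la : seq nat) :=
  cyclic_mx (regS n) (gring_row (young_symmetrizer n la)).

Definition specht_module (n : nat) (la : seq nat) :
    mxmodule (regS n) (specht_submod n la) :=
  cyclic_mx_module (regS n) (gring_row (young_symmetrizer n la)).

Definition specht_repr (n : nat) (la : seq nat) :=
  submod_repr (specht_module n la).

Definition specht_tensor4 (n : nat) (la : seq nat) :=
  let V := specht_repr n la in
  prod_repr (prod_repr (prod_repr V V) V) V.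

(* Main.v *)
Require Import Defs.
From mathcomp Require Import all_boot all_order all_fingroup all_algebra.
From mathcomp Require Import all_solvable all_field all_character.
From mathcomp Require Import zify.

(** Why the theorem is true.

    Matrix coefficients.  The functions g |-> tr (A rho(g)) attached to a
    representation rho multiply under tensor products.  If the function that
    is supported at g = 1 alone is such a coefficient, then every irreducible
    occurs in rho: the central idempotent of an irreducible that does not occur
    acts as 0, whereas pairing it with that coefficient gives a nonzero multiple
    of its value at 1 (mxcoef_delta_constt).  So it suffices to find four
    matrix coefficients of the Specht module whose product is supported at 1.

    Coefficients of the Specht module.  Let y(z) be the coefficient of z in the
    Young symmetrizer.  All functions g |-> y(b g^-1 a) are matrix
    coefficients (mxcoef_specht), and y(z) is nonzero only if z is in R C, where
    R is the row group and C the column group.  Moreover y = 1 on R.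

    Two factors.  Let x in R reverse every row, and let L(k) be the length of
    the row of box k.  If w and w x are both in R C, then w preserves L.  Indeed
    put F = L o w^-1.  Since w is in R C, the sum of F(k) col(k) equals that of
    L(k) col(k); since w x is in R C, the same holds with col replaced by the
    position counted from the right end of the row.  The two positions add up
    to L - 1, so the sum of F L equals the sum of L^2, which is also the sum of
    F^2, and thus F = L (young_coef_row_length).

    Four factors.  Let h be a permutation of the boxes such that the pairs
    (L(k), L(h(k))) are distinct.  With w = g^-1, if
    y(w) y(w x) y(w^h) y(w^h x) is nonzero, then w preserves both L and L o h,
    so w = 1; and this product is 1 at w = 1
    (specht_tensor4_contains_all).

    Choice of the partition.  If the part v has multiplicity m(v), the
    function L takes the value v exactly v m(v) times, so an h as above is the
    same as a 0-1 matrix whose v-th row and v-th column both have sum v m(v)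
    (length_perm_exists).  For n = 1 + ... + d + r with r < d, add r parts 1 to
    the staircase (d, ..., 1); for r = d, add one part 2 and d - 2 parts 1.
    Matrices with these margins are written down explicitly. *)

Section Proof.
Set Implicit Arguments.
Unset Strict Implicit.
Unset Printing Implicit Defensive.
Import GroupScope GRing.Theory Num.Theory.
Local Open Scope ring_scope.

(** * Matrix coefficients and irreducible constituents *)

Section MatrixCoefficients.

Lemma idempotent_mxtrace (F : fieldType) m (A : 'M[F]_m) :
  A *m A = A -> \tr A = (\rank A)%:R.
Proof.
move=> AA; have CR := mulmx_base A.
set C := col_base A in CR; set R := row_base A in CR.
have RC : R *m C = 1%:M.
  apply: (row_free_inj (row_base_free A)); apply: (row_full_inj (col_base_full A)).
  by rewrite /= -/C -/R mul1mx CR -mulmxA CR mulmxA CR.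
by rewrite -[in LHS]CR mxtrace_mulC RC mxtrace1.
Qed.

Definition mxcoef (gT : finGroupType) (G : {group gT}) m
    (rG : mx_representation algC G m) (f : gT -> algC) :=
  exists A : 'M_m, {in G, forall g, f g = \tr (A *m rG g)}.

Variables (gT : finGroupType) (G : {group gT}).

Lemma mxcoef_prod m1 m2 (r1 : mx_representation algC G m1)
    (r2 : mx_representation algC G m2) f1 f2 :
  mxcoef r1 f1 -> mxcoef r2 f2 -> mxcoef (prod_repr r1 r2) (fun g => f1 g * f2 g).
Proof.
move=> [A HA] [B HB]; exists (tprod A B) => g Gg.
by rewrite HA // HB //= -tprodE mxtrace_prod.
Qed.

Lemma mxcoef_submod m (rG : mx_representation algC G m) (U : 'M_m)
    (modU : mxmodule rG U) (u : 'rV_m) (i : 'I_m) :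
  (u <= U)%MS -> mxcoef (submod_repr modU) (fun g => (u *m rG g) 0 i).
Proof.
move=> Uu; exists (val_submod 1%:M *m delta_mx i 0 *m in_submod U u) => g Gg.
have cyclic_trace k (V : 'M[algC]_(k, m)) (c : 'cV_m) (x : 'rV_k) (r : 'M_k) :
    \tr (V *m c *m x *m r) = (x *m r *m V *m c) 0 0.
  by rewrite -[_ *m r]mulmxA mxtrace_mulC [_ *m (V *m c)]mulmxA /mxtrace big_ord1.
by rewrite cyclic_trace -val_submodE val_submodJ // in_submodK // -colE [RHS]mxE.
Qed.

(** If 'chi_j does not occur, its central idempotent e acts by an idempotent
    matrix P whose trace, the multiplicity times 'chi_j(1), vanishes; in
    characteristic 0 this forces P = 0.  But P is a combination of the rG g with
    weights 'chi_j(g^-1), so the linear form that gives f sends P to a nonzero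
    multiple of f(1) 'chi_j(1). *)
Lemma mxcoef_delta_constt m (rG : mx_representation algC G m) (f : gT -> algC) :
    mxcoef rG f -> f 1%g != 0 -> {in G, forall g, f g != 0 -> g = 1%g} ->
  forall j : Iirr G, j \in irr_constt (cfRepr rG).
Proof.
move=> [A HA] f1 fn1 j; rewrite irr_consttE; apply/eqP => Hj.
set e := Wedderburn_id (socle_of_Iirr j).
have [_ eR ee _] := Wedderburn_is_id_pchar (algC'G_pchar G) (socle_of_Iirr j).
have eG : (e \in group_ring algC G)%MS.
  by move: eR; rewrite genmxE mem_sub_gring => /andP[].
set P := gring_op rG e.
have PP : P *m P = P by rewrite -gring_opM // ee.
have trP : \tr P = 0.
  rewrite -xcfun_repr [cfRepr rG]cfun_sum_constt.
  rewrite -xcfun_rE raddf_sum big1 // => i; rewrite irr_consttE => Hi.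
  rewrite /= xcfunZl xcfun_id; case: eqP => [ij|_]; last by rewrite mulr0.
  by rewrite ij Hj eqxx in Hi.
have P0 : P = 0.
  by apply/eqP; rewrite -mxrank_eq0 -(@pnatr_eq0 algC) -idempotent_mxtrace // trP.
have : \tr (A *m P) = 0 by rewrite P0 mulmx0 mxtrace0.
rewrite /P /e Wedderburn_id_expansion linearZ /= linear_sum -scalemxAr linearZ /=.
move/eqP; rewrite mulf_eq0 invr_eq0 pnatr_eq0 eqn0Ngt cardG_gt0 //=; apply/negP.
rewrite mulmx_sumr raddf_sum (bigD1 1%g) //= big1 ?addr0.
  rewrite linearZ /= gring_opG // -scalemxAr linearZ /= -HA // invg1.
  by rewrite !mulf_neq0 ?irr1_neq0.
move=> g /andP[Gg g1]; rewrite linearZ /= gring_opG // -scalemxAr linearZ /= -HA //.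
have /eqP-> : f g == 0 by apply: contraNT g1 => /(fn1 _ Gg)->.
by rewrite mulr0.
Qed.
End MatrixCoefficients.
(** * The Young symmetrizer as a function on the group *)

Section SpechtCoefficients.
Variables (n : nat) (la : seq nat).
Local Notation R := (row_stab n la).
Local Notation C := (col_stab n la).

(** Coefficient of z in the Young symmetrizer.  Row and column group meet
    trivially, so at most one term of the sum is present. *)
Definition young_coef (z : 'S_n) : algC :=
  \sum_(p in R) \sum_(q in C | (p * q)%g == z) (-1) ^+ (q : bool).

Lemma young_symmetrizer_row (a b : 'S_n) :
  (gring_row (young_symmetrizer n la) *m regS n a) 0 (gring_index [set: 'S_n] b)
    = young_coef (b * a^-1)%g.
Proof.
rewrite /young_symmetrizer mulmx_suml linear_sum mulmx_suml summxE /young_coef.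
apply: eq_bigr => p _; rewrite mulmx_sumr linear_sum mulmx_suml summxE [RHS]big_mkcondr.
apply: eq_bigr => q _; rewrite /= -scalemxAr linearZ /= -scalemxAl mxE.
rewrite -gring_row_mul -!repr_mxM ?inE //.
rewrite /gring_row rowK gring_indexK ?inE // mul1g !mxE eqxx /=.
rewrite (can_in_eq (@gring_indexK _ _)) ?inE // mulr_natr mulrb.
by rewrite [in RHS]eq_sym -[in RHS](inj_eq (mulIg a)) mulgKV.
Qed.

Lemma mxcoef_specht (a b : 'S_n) :
  mxcoef (specht_repr n la) (fun g => young_coef (b * g^-1 * a)%g).
Proof.
pose u := gring_row (young_symmetrizer n la) *m regS n a^-1%g.
have Uu : (u <= specht_submod n la)%MS.
  by apply: mxmodule_trans; [exact: specht_module | rewrite inE | exact: cyclic_mx_id].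
have [A HA] := mxcoef_submod (specht_module n la) (gring_index _ b) Uu.
(* The entry at b of the vector u g is the coefficient of b in y a^-1 g. *)
exists A => g Gg; rewrite -HA // /u -mulmxA -repr_mxM ?inE //.
by rewrite young_symmetrizer_row invMg invgK mulgA.
Qed.

Lemma young_coef_neq0 (z : 'S_n) :
  young_coef z != 0 -> exists p q, [/\ p \in R, q \in C & z = (p * q)%g].
Proof.
move=> z0; case: (pickP [pred u : 'S_n * 'S_n | [&& u.1 \in R, u.2 \in C & z == (u.1 * u.2)%g]]).
  by move=> [p q] /= /and3P[Rp Cq /eqP ->]; exists p, q.
move=> none; case/negP: z0; rewrite /young_coef big1 // => p Rp.
by rewrite big_pred0 // => q; have := none (p, q); rewrite /= Rp eq_sym.
Qed.

End SpechtCoefficients.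
(** * Row lengths of boxes *)

Section Boxes.
Variables (n : nat) (la : seq nat).
Hypothesis la_n : sumn la = n.
Local Open Scope nat_scope.
Local Notation R := (row_stab n la).
Local Notation C := (col_stab n la).
Local Notation box_row := (reshape_index la).
Local Notation box_col := (reshape_offset la).

Definition row_length (k : nat) : nat := nth 0 la (box_row k).
Local Notation L := row_length.

Lemma box_inj (i k : 'I_n) : box_row i = box_row k -> box_col i = box_col k -> i = k.
Proof.
by move=> r c; apply: val_inj; rewrite /= -(reshape_indexK la i) r c reshape_indexK.
Qed.

Lemma row_stabP (p : 'S_n) : reflect (forall k, box_row (p k) = box_row k) (p \in R).
Proof. by rewrite inE; apply: (iffP forallP) => H k; apply/eqP; rewrite ?H. Qed.

Lemma col_stabP (q : 'S_n) : reflect (forall k, box_col (q k) = box_col k) (q \in C).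
Proof. by rewrite inE; apply: (iffP forallP) => H k; apply/eqP; rewrite ?H. Qed.

Lemma row_stabV (p : 'S_n) k : p \in R -> box_row (p^-1%g k) = box_row k.
Proof. by move/row_stabP/(_ (p^-1%g k)); rewrite permKV. Qed.

Lemma col_stabV (q : 'S_n) k : q \in C -> box_col (q^-1%g k) = box_col k.
Proof. by move/col_stabP/(_ (q^-1%g k)); rewrite permKV. Qed.

Lemma young_coef_row_stab (x : 'S_n) : x \in R -> young_coef la x = 1%R.
Proof.
move=> Rx; have rc (p q : 'S_n) : p \in R -> q \in C -> (p * q)%g = x -> q = 1%g.
  move=> Rp Cq pqx; apply/permP=> k; rewrite perm1; apply: box_inj; last exact/col_stabP.
  have := row_stabP _ Rx (p^-1%g k); rewrite -pqx permM permKV => ->.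
  exact: row_stabV.
rewrite /young_coef (bigD1 x) //= (bigD1 1%g) /=; last first.
  by rewrite mulg1 eqxx andbT; apply/col_stabP=> k; rewrite perm1.
rewrite odd_perm1 expr0 big1 ?addr0 => [|q /andP[/andP[Cq /eqP]]]; last first.
  by move/(rc _ _ Rx Cq)->; rewrite eqxx.
rewrite big1 ?addr0 // => p /andP[Rp px]; rewrite big1 // => q /andP[Cq /eqP pqx].
by move: px; rewrite -pqx (rc _ _ Rp Cq pqx) mulg1 eqxx.
Qed.

(** Translating by x means using a second tableau with the same rows but other
    columns; for the reversal, the two column numbers of a box add up to a
    quantity that depends on the length of its row alone. *)
Lemma row_reversal_exists :
  exists2 x : 'S_n, x \in R & forall k : 'I_n, box_col (x k) + (box_col k).+1 = L k.
Proof.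
have colP (k : 'I_n) : box_col k < L k by apply: reshape_offsetP; rewrite la_n.
pose c (k : 'I_n) := L k - (box_col k).+1.
have cP (k : 'I_n) : c k < L k by rewrite /c; have := colP k; lia.
have fP (k : 'I_n) : flatten_index la (box_row k) (c k) < n.
  by rewrite -[X in _ < X]la_n flatten_indexP.
pose f k := Ordinal (fP k).
have fr k : box_row (f k) = box_row k by apply: flatten_indexKl; apply: cP.
have fc k : box_col (f k) = c k by apply: flatten_indexKr; apply: cP.
have f_inj : injective f.
  move=> i k fik; have r : box_row i = box_row k by rewrite -fr fik fr.
  apply: box_inj => //; have := fc i; rewrite fik fc /c /L r.
  by have := colP i; have := colP k; rewrite /L r; lia.
exists (perm f_inj) => [|k]; first by apply/row_stabP=> k; rewrite permE.
by rewrite permE fc /c; have := colP k; lia.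
Qed.

(** Equality case of 2 f g <= f^2 + g^2, summed over I. *)
Lemma eq_of_sum_mul (I : finType) (f g : I -> nat) :
    \sum_i f i * g i = \sum_i g i * g i -> \sum_i f i * f i = \sum_i g i * g i ->
  f =1 g.
Proof.
move=> fg ff i.
have [_] := leqif_sum (fun k (_ : true) => nat_Cauchy (f k) (g k)).
rewrite -big_distrr big_split /= fg.
have sq (h : I -> nat) : \sum_k h k ^ 2 = \sum_k h k * h k.
  by apply: eq_bigr => k _; rewrite mulnn.
by rewrite !sq ff addnn mul2n eqxx => /esym/forallP/(_ i)/eqP.
Qed.

Lemma row_length_mul_row_stab (w : 'S_n) p q k :
  p \in R -> w = (p * q)%g -> L (w^-1%g k) = L (q^-1%g k).
Proof. by move=> Rp ->; rewrite invMg permM /L (row_stabV _ Rp). Qed.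

(** Writing w = p q, the values of L o w^-1 and of L o q^-1 agree, and q^-1
    stays in its column: hence L o w^-1 and L have the same inner product with
    the column number.  Doing this for w x as well gives the inner product with
    the column number counted from the right; adding the two gives the inner
    product with L itself, and the equality case of Cauchy's inequality
    applies. *)
Lemma young_coef_row_length (x w : 'S_n) :
    x \in R -> (forall k : 'I_n, box_col (x k) + (box_col k).+1 = L k) ->
    young_coef la w != 0%R -> young_coef la (w * x)%g != 0%R ->
  forall k, L (w^-1%g k) = L k.
Proof.
move=> Rx xc /young_coef_neq0[p [q [Rp Cq wE]]] /young_coef_neq0[p' [q' [Rp' Cq' wxE]]].
pose F k := L (w^-1%g k).
have sum_perm (G : 'I_n -> nat) (z : 'S_n) : \sum_k G (z k) = \sum_k G k.
  by rewrite [RHS](reindex_inj (@perm_inj _ z)).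
have Fc : \sum_k F k * box_col k = \sum_(k < n) L k * box_col k.
  rewrite -[RHS](sum_perm _ q^-1%g); apply: eq_bigr => k _.
  by rewrite /F (row_length_mul_row_stab _ Rp wE) (col_stabV _ Cq).
have Fcx : \sum_k F k * box_col (x k) = \sum_(k < n) L k * box_col k.
  rewrite -[RHS](sum_perm _ q'^-1%g) -[RHS](sum_perm _ x); apply: eq_bigr => k _.
  rewrite -(row_length_mul_row_stab _ Rp' wxE) (col_stabV _ Cq').
  by rewrite invMg permM permK.
have Lcx : \sum_(k < n) L k * box_col (x k) = \sum_(k < n) L k * box_col k.
  by rewrite -[RHS](sum_perm _ x); apply: eq_bigr => k _; rewrite /L (row_stabP _ Rx).
have mul_length (G : 'I_n -> nat) : \sum_k G k * L k =
    \sum_k G k * box_col (x k) + \sum_k G k * box_col k + \sum_k G k.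
  by rewrite -!big_split; apply: eq_bigr => k _ /=; rewrite -xc; lia.
have sumF : \sum_k F k = \sum_(k < n) L k by rewrite (sum_perm (fun k => L k)).
apply: eq_of_sum_mul; last exact: (sum_perm (fun k => L k * L k)).
by rewrite !mul_length Fc Fcx Lcx sumF.
Qed.

(** Translating by h^-1 and h turns the condition that w preserves L into the
    condition that w preserves L o h; together they pin down every box. *)
Lemma specht_tensor4_contains_all (h : 'S_n) :
    injective (fun k : 'I_n => (L k, L (h k))) ->
  forall j : Iirr [set: 'S_n], j \in irr_constt (cfRepr (specht_tensor4 n la)).
Proof.
move=> h_inj; have [x Rx xc] := row_reversal_exists.
pose y (b a : 'S_n) (g : 'S_n) := young_coef la (b * g^-1 * a)%g.
have yP b a : mxcoef (specht_repr n la) (y b a) := mxcoef_specht la a b.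
pose f g := (y 1%g 1%g g * y 1%g x g * y h^-1%g h g * y h^-1%g (h * x)%g g)%R.
have fP : mxcoef (specht_tensor4 n la) f by do 3!apply: mxcoef_prod => //.
apply: (mxcoef_delta_constt fP) => [|g _].
  have R1 : 1%g \in R by apply/row_stabP=> k; rewrite perm1.
  rewrite /f /y !invg1 !mulg1 !mul1g mulKg mulVg.
  by rewrite !young_coef_row_stab // !mulr1 oner_neq0.
rewrite /f /y mulg1 !mul1g mulgA !mulf_eq0 !negb_or -!andbA => /and4P[y1 y2 y3 y4].
have rowL := young_coef_row_length Rx xc y1 y2.
have colL := young_coef_row_length Rx xc y3 y4.
apply/permP=> k; rewrite perm1; apply: h_inj; congr pair.
  by rewrite -[RHS]rowL invgK.
have := colL (h k).
by rewrite !invMg !invgK !permM permK.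
Qed.

Lemma map_row_length : map L (iota 0 n) = flatten [seq nseq a a | a <- la].
Proof.
have sh : shape [seq nseq a a | a <- la] = la.
  by rewrite /shape -map_comp map_id_in // => a _; apply: size_nseq.
apply: (@eq_from_nth _ 0) => [|i]; first by rewrite size_map size_iota size_flatten sh.
rewrite size_map size_iota => lt_in; rewrite (nth_map 0) ?size_iota // nth_iota // add0n.
have lt_i : i < sumn la by rewrite la_n.
rewrite nth_flatten sh (nth_map 0) ?reshape_indexP // nth_nseq.
by rewrite reshape_offsetP.
Qed.

Lemma count_row_length v : count_mem v (map L (iota 0 n)) = v * count_mem v la.
Proof.
rewrite map_row_length count_flatten -map_comp; elim: (la) => [|a s IH] /=; first by rewrite muln0.
by rewrite IH count_nseq mulnDr /= mulnC; case: eqP => [->|_]; rewrite ?muln0.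
Qed.

(** List the n cells of P in any order.  Sorting the boxes in two ways, so that
    their row lengths run through the first, respectively the second,
    coordinates of the cells, gives two permutations; h is the passage from one
    to the other. *)
Lemma length_perm_exists (P : seq (nat * nat)) : uniq P ->
    (forall v, count_mem v (map fst P) = v * count_mem v la) ->
    (forall v, count_mem v (map snd P) = v * count_mem v la) ->
  exists h : 'S_n, injective (fun k : 'I_n => (L k, L (h k))).
Proof.
move=> uP P1 P2; pose t := [tuple L k | k < n].
have tE : t = map L (iota 0 n) :> seq nat by rewrite -val_enum_ord -map_comp.
have t1 : perm_eq (map fst P) t.
  by apply/allP=> v _; rewrite /= tE count_row_length P1.
have t2 : perm_eq (map snd P) t.
  by apply/allP=> v _; rewrite /= tE count_row_length P2.
have [p1 E1] := tuple_permP t1; have [p2 E2] := tuple_permP t2.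
have szP : size P = n by rewrite -(size_map fst) (perm_size t1) size_tuple.
have nthP (k : 'I_n) : nth (0, 0) P k = (L (p1 k), L (p2 k)).
  have kP : k < size P by rewrite szP.
  rewrite [LHS]surjective_pairing -(nth_map _ 0 fst) // -(nth_map _ 0 snd) // E1 E2.
  by rewrite -!tnth_nth !tnth_mktuple.
exists (p1^-1 * p2)%g => i k; rewrite !permM.
rewrite -{1}(permKV p1 i) -{1}(permKV p1 k) -!nthP => /eqP.
by rewrite nth_uniq ?szP // => /eqP/val_inj/perm_inj.
Qed.
End Boxes.
(** * Zero-one matrices with prescribed margins *)

Section ZeroOneMatrices.
Local Open Scope nat_scope.

Definition all_in_tensor4 n := exists la : seq nat, is_partition n la /\
  forall j : Iirr [set: 'S_n], j \in irr_constt (cfRepr (specht_tensor4 n la)).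

Lemma count_sum (T : Type) (a : pred T) s : count a s = \sum_(i <- s) a i.
Proof. by rewrite -sum1_count big_mkcond; apply: eq_bigr => i _; case: (a i). Qed.

Lemma count_allpairs (a : pred (nat * nat)) (s t : seq nat) :
  count a [seq (i, j) | i <- s, j <- t] = \sum_(i <- s) \sum_(j <- t) a (i, j).
Proof. by rewrite count_sum big_allpairs_dep. Qed.

Lemma sum_eq_mem (s : seq nat) v (F : nat -> nat) : uniq s ->
  \sum_(i <- s) (i == v) * F i = (v \in s) * F v.
Proof.
elim: s => [|i s IH] /=; first by rewrite big_nil.
case/andP=> i_s us; rewrite big_cons IH // inE eq_sym.
by case: eqP i_s => [-> /negPf->|_ _]; rewrite ?addn0.
Qed.

(** The relation A is a 0-1 matrix with rows and columns numbered 1, ..., d by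
    the possible row lengths; the list s holds the parts in any order. *)
Lemma all_in_tensor4_of_matrix d (s : seq nat) (A : rel nat) :
    (forall v, v \in s -> 0 < v <= d) ->
    (forall v, 0 < v <= d -> count (A v) (iota 1 d) = v * count_mem v s) ->
    (forall v, 0 < v <= d -> count (A^~ v) (iota 1 d) = v * count_mem v s) ->
  all_in_tensor4 (sumn s).
Proof.
move=> s_d rowA colA; exists (sort geq s).
have sum_la : sumn (sort geq s) = sumn s by apply: perm_sumn; rewrite perm_sort.
split.
  rewrite /is_partition sum_la eqxx mem_sort sort_sorted; last by move=> i j; exact: leq_total.
  by rewrite andbT; apply: contraTN isT => /s_d.
pose P := [seq p <- [seq (i, j) | i <- iota 1 d, j <- iota 1 d] | A p.1 p.2].
have out v : v \notin iota 1 d -> count_mem v s = 0.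
  move=> vd; apply/count_memPn; apply: contra vd => /s_d; rewrite mem_iota; lia.
have [|v|v|h] := length_perm_exists sum_la (P := P).
- apply: filter_uniq; apply: allpairs_uniq; rewrite ?iota_uniq //.
  by move=> [? ?] [? ?].
- rewrite count_map count_filter count_allpairs /=.
  have rows i : \sum_(j <- iota 1 d) ((i == v) && A i j) = (i == v) * count (A i) (iota 1 d).
    by rewrite count_sum big_distrr; apply: eq_bigr => j _; rewrite -mulnb.
  under eq_bigr do rewrite rows.
  rewrite sum_eq_mem ?iota_uniq // count_sort; case: (boolP (v \in _)) => [|/out->].
    by rewrite mem_iota mul1n => vd; apply: rowA; lia.
  by rewrite muln0.
- rewrite count_map count_filter count_allpairs exchange_big /=.
  have cols j : \sum_(i <- iota 1 d) ((j == v) && A i j) = (j == v) * count (A^~ j) (iota 1 d).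
    by rewrite count_sum big_distrr; apply: eq_bigr => i _; rewrite -mulnb.
  under eq_bigr do rewrite cols.
  rewrite sum_eq_mem ?iota_uniq // count_sort; case: (boolP (v \in _)) => [|/out->].
    by rewrite mem_iota mul1n => vd; apply: colA; lia.
  by rewrite muln0.
by move=> h_inj j; apply: specht_tensor4_contains_all h_inj j.
Qed.

Lemma count_of_list (a : pred nat) s t : uniq s -> uniq t ->
  (forall x, (x \in t) = a x && (x \in s)) -> count a s = size t.
Proof.
move=> us ut st; rewrite -size_filter; apply/perm_size/uniq_perm => // [|x].
  exact: filter_uniq.
by rewrite mem_filter st.
Qed.

(** The staircase matrix d < i + j has i cells in row i and in column i.  For
    each i in 2, ..., r + 1 its cell (i, d + 1 - i) is removed and the cells
    (i, 1) and (1, d + 1 - i) are added: this keeps the sums of row i and of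
    column d + 1 - i, and gives one more cell to row 1 and to column 1.  For
    i = d, which occurs when r = d - 1, the cell (d, 1) is put back and only the
    cell (1, 1) is new, with the same effect on row 1 and column 1. *)
Definition staircase_plus_ones d r : rel nat := fun i j =>
  if i == 1 then d <= j + r
  else if i <= r.+1 then (j == 1) || (d.+2 <= i + j) else d < i + j.

Lemma all_in_tensor4_plus_ones d r : r < d -> all_in_tensor4 (sumn (iota 1 d) + r).
Proof.
move=> rd; pose s := iota 1 d ++ nseq r 1.
have -> : sumn (iota 1 d) + r = sumn s by rewrite sumn_cat sumn_nseq mul1n.
have cs v : 0 < v <= d -> v * count_mem v s = v + (v == 1) * r.
  move=> vd; rewrite count_cat count_nseq count_uniq_mem ?iota_uniq // mem_iota /=.
  by rewrite vd /= mulnDr muln1; case: v vd => [|[|v]] /=; lia.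
apply: (@all_in_tensor4_of_matrix d _ (staircase_plus_ones d r)) => v.
- by rewrite mem_cat mem_iota mem_nseq; lia.
- move=> vd; rewrite cs //; have [v1|v1] := eqVneq v 1.
    rewrite (@count_of_list _ _ (iota (d - r) r.+1)) ?iota_uniq ?size_iota //; first by lia.
    by move=> j; rewrite !mem_iota /staircase_plus_ones v1 /=; lia.
  have [vr|vr] := leqP v r.+1.
    rewrite (@count_of_list _ _ (1 :: iota (d.+2 - v) v.-1)) ?iota_uniq //=; last first.
    + by move=> j; rewrite !inE !mem_iota /staircase_plus_ones (negPf v1) vr; lia.
    + by rewrite iota_uniq mem_iota; lia.
    by rewrite size_iota; lia.
  rewrite (@count_of_list _ _ (iota (d.+1 - v) v)) ?iota_uniq ?size_iota //; first by lia.
  by move=> j; rewrite !mem_iota /staircase_plus_ones (negPf v1) (leqNgt v) vr /=; lia.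
- move=> vd; rewrite cs //; have [v1|v1] := eqVneq v 1.
    have [rd1|rd1] := eqVneq r.+1 d.
      rewrite (@count_of_list _ _ (iota 1 d)) ?iota_uniq ?size_iota //; first by lia.
      by move=> i; rewrite !mem_iota /staircase_plus_ones v1; do ?[case: ifP => ?]; lia.
    rewrite (@count_of_list _ _ (d :: iota 2 r)) ?iota_uniq //=; last first.
    + by move=> i; rewrite !inE !mem_iota /staircase_plus_ones v1; do ?[case: ifP => ?]; lia.
    + by rewrite iota_uniq mem_iota; lia.
    by rewrite size_iota; lia.
  have [vr|vr] := leqP d (v + r).
    rewrite (@count_of_list _ _ (1 :: iota (d.+2 - v) v.-1)) ?iota_uniq //=; last first.
    + by move=> i; rewrite !inE !mem_iota /staircase_plus_ones; do ?[case: ifP => ?]; lia.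
    + by rewrite iota_uniq mem_iota; lia.
    by rewrite size_iota; lia.
  rewrite (@count_of_list _ _ (iota (d.+1 - v) v)) ?iota_uniq ?size_iota //; first by lia.
  by move=> i; rewrite !mem_iota /staircase_plus_ones; do ?[case: ifP => ?]; lia.
Qed.

(** The margins v for v > 2, together with 4 in row and column 2 and d - 1 in
    row and column 1.  Row 1 and column 1 are full except at their common cell.
    What is left must have sum v - 1 in line v > 2 and sum 3 in line 2: it is the
    staircase of size d - 1, on the lines 2, ..., d, with the cell (3, d - 1)
    replaced by the cells (2, 2), (3, 2) and (2, d - 1). *)
Definition staircase_plus_two d : rel nat := fun i j =>
  if i == 1 then 1 < j else if i == 2 then j \in [:: 1; 2; d.-1; d]
  else if i == 3 then j \in [:: 1; 2; d] else (j == 1) || (1 < j) && (d.+2 <= i + j).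

Lemma all_in_tensor4_plus_two d : 4 < d -> all_in_tensor4 (sumn (iota 1 d) + d).
Proof.
move=> d4; pose s := iota 1 d ++ 2 :: nseq (d - 2) 1.
have -> : sumn (iota 1 d) + d = sumn s by rewrite sumn_cat /= sumn_nseq mul1n; lia.
have cs v : 0 < v <= d -> v * count_mem v s = v + (v == 1) * (d - 2) + (v == 2) * 2.
  move=> vd; rewrite count_cat /= count_nseq count_uniq_mem ?iota_uniq // mem_iota /=.
  by rewrite vd /= !mulnDr muln1; case: v vd => [|[|[|v]]] /=; lia.
have list_count v a (t : seq nat) : 0 < v <= d -> uniq t ->
    (forall x, (x \in t) = a x && (x \in iota 1 d)) ->
    size t = v + (v == 1) * (d - 2) + (v == 2) * 2 ->
    count a (iota 1 d) = v * count_mem v s.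
  by move=> vd ut at_ szt; rewrite cs // -szt; apply: count_of_list; rewrite ?iota_uniq.
apply: (@all_in_tensor4_of_matrix d _ (staircase_plus_two d)) => v.
- by rewrite mem_cat inE mem_iota mem_nseq; lia.
- move=> vd; have [v1|v1] := eqVneq v 1.
    apply: (list_count _ _ (iota 2 d.-1)); rewrite ?iota_uniq ?size_iota //; last by lia.
    by move=> j; rewrite !mem_iota /staircase_plus_two v1 /=; lia.
  have [v2|v2] := eqVneq v 2.
    apply: (list_count _ _ [:: 1; 2; d.-1; d]) => //=; rewrite ?inE; [lia| |lia].
    by move=> j; rewrite !inE mem_iota /staircase_plus_two v2 /= !inE; lia.
  have [v3|v3] := eqVneq v 3.
    apply: (list_count _ _ [:: 1; 2; d]) => //=; rewrite ?inE; [lia| |lia].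
    by move=> j; rewrite !inE mem_iota /staircase_plus_two v3 /= !inE; lia.
  apply: (list_count _ _ (1 :: iota (d.+2 - v) v.-1)) => //=; rewrite ?size_iota; [|move=> j|lia].
    by rewrite iota_uniq mem_iota; lia.
  by rewrite inE !mem_iota /staircase_plus_two (negPf v1) (negPf v2) (negPf v3); lia.
- move=> vd; have [v1|v1] := eqVneq v 1.
    apply: (list_count _ _ (iota 2 d.-1)); rewrite ?iota_uniq ?size_iota //; last by lia.
    by move=> i; rewrite !mem_iota /staircase_plus_two v1 !inE; do ?[case: ifP => ?]; rewrite ?inE; lia.
  have [v2|v2] := eqVneq v 2.
    apply: (list_count _ _ [:: 1; 2; 3; d]) => //=; rewrite ?inE; [lia| |lia].
    by move=> i; rewrite !inE mem_iota /staircase_plus_two v2 !inE; do ?[case: ifP => ?]; rewrite ?inE; lia.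
  have [vd1|vd1] := eqVneq v d.-1.
    apply: (list_count _ _ (1 :: 2 :: iota 4 (d - 3))) => //=; rewrite ?size_iota; [|move=> i|lia].
      by rewrite iota_uniq !inE !mem_iota; lia.
    by rewrite !inE !mem_iota /staircase_plus_two vd1 !inE; do ?[case: ifP => ?]; rewrite ?inE; lia.
  have [vd2|vd2] := eqVneq v d.
    apply: (list_count _ _ (iota 1 d)); rewrite ?iota_uniq ?size_iota //; last by lia.
    by move=> i; rewrite !mem_iota /staircase_plus_two vd2 !inE; do ?[case: ifP => ?]; rewrite ?inE; lia.
  apply: (list_count _ _ (1 :: iota (d.+2 - v) v.-1)) => //=; rewrite ?size_iota; [|move=> i|lia].
    by rewrite iota_uniq mem_iota; lia.
  by rewrite inE !mem_iota /staircase_plus_two !inE; do ?[case: ifP => ?]; rewrite ?inE; lia.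
Qed.

Lemma triangular_decomposition n : exists d r, r <= d /\ n = sumn (iota 1 d) + r.
Proof.
elim: n => [|n [d [r [rd ->]]]]; first by exists 0, 0.
have [lt_rd|ge_rd] := ltnP r d; first by exists d, r.+1; rewrite addnS.
exists d.+1, 0; split=> //; rewrite -[d.+1]addn1 iotaD sumn_cat /=; lia.
Qed.
End ZeroOneMatrices.
End Proof.

Theorem theorem1p4 :
  exists N : nat, forall n : nat, N <= n ->
    exists la : seq nat, is_partition n la /\
      forall j : Iirr [set: 'S_n],
        j \in irr_constt (cfRepr (specht_tensor4 n la)).
Proof.
(* For n >= 15 = 1 + 2 + 3 + 4 + 5 the staircase has size d >= 5. *)
exists 15 => n; have [d [r [rd ->]]] := triangular_decomposition n => n15.
have [lt_rd|ge_rd] := ltnP r d; first exact: all_in_tensor4_plus_ones.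
have -> : r = d by apply/eqP; rewrite eqn_leq rd.
apply: all_in_tensor4_plus_two; rewrite ltnNge; apply/negP => d4.
by case: d d4 rd {ge_rd} n15 => [|[|[|[|[|d]]]]] //= _; lia.
Qed.
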